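(* Let $G$ be a graph with $\mathrm{mad}(G)<\frac{10}{3}$. Then $\chi_c^{\star}(G)\leq 4$. In particular, every planar graph of girth at least $5$ satisfies $\chi_\ell^\star(G)\le\chi_c^\star(G)\leq 4$.
   Context: All graphs are finite and simple. $\mathrm{mad}(G)$ denotes the maximum, over all subgraphs of $G$, of their average degree. A correspondence-cover of a graph $G$ is a pair $(L,H)$ where $H$ is a graph and $L$ maps each $v\in V(G)$ to a subset $L(v)\subseteq V(H)$ such that: the sets $L(v)$ partition $V(H)$; each $L(v)$ induces a clique in $H$; if $uv\notin E(G)$ there are no edges of $H$ between $L(u)$ and $L(v)$; if $uv\in E(G)$ the edges of $H$ between $L(u)$ and $L(v)$ form a matching. The cover is $k$-fold if $|L(v)|=k$ for all $v$. An independent transversal of $(L,H)$ is an independent set of $H$ containing exactly one vertex of each $L(v)$. A $k$-fold cover has a packing if it has $k$ pairwise vertex-disjoint independent transversals. The correspondence packing number $\chi_c^{\star}(G)$ is the least $k\geq 1$ such that every $k$-fold correspondence-cover of $G$ has a packing. A list-assignment $L$ (with $L(v)\subseteq\mathbb{N}$) gives the list-cover with vertices $(v,x)$, $x\in L(v)$, cliques on each list, and edges $(u,x)(v,x)$ for $uv\in E(G)$; $\chi_\ell^\star(G)$ is defined like $\chi_c^\star(G)$ but only over $k$-fold list-covers. *)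

(* Defs.v *)
From mathcomp Require Import all_boot all_order all_algebra.
Set Implicit Arguments. Unset Strict Implicit. Unset Printing Implicit Defensive.
Import Order.TTheory GRing.Theory Num.Theory.

Definition simple_graph (T : finType) (e : rel T) : Prop :=
  symmetric e /\ irreflexive e.

Definition avg_deg (T : finType) (S : {set T}) (F : rel T) : rat :=
  ((\sum_(v in S) #|[set u in S | F v u]|)%:R / #|S|%:R)%R.

(* A subgraph is a nonempty vertex set S with a symmetric sub-relation F of e
   (edges of F outside S are ignored, i.e. only edges inside S count). *)
Definition mad_lt (T : finType) (e : rel T) (r : rat) : Prop :=
  forall (S : {set T}) (F : rel T),
    S != set0 -> symmetric F -> subrel F e -> (avg_deg S F < r)%R.

Definition corr_cover (T : finType) (e : rel T)
    (VH : finType) (h : rel VH) (L : T -> {set VH}) : Prop :=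
  simple_graph h /\
  (forall x : VH, exists v, x \in L v) /\
  (forall u v : T, u != v -> [disjoint L u & L v]) /\
  (forall v (x y : VH), x \in L v -> y \in L v -> x != y -> h x y) /\
  (forall u v (x y : VH), u != v -> ~~ e u v -> x \in L u -> y \in L v -> ~~ h x y) /\
  (forall u v (x y y' : VH), e u v -> x \in L u -> y \in L v -> y' \in L v ->
      h x y -> h x y' -> y = y').

Definition k_fold (T : finType) (VH : finType) (L : T -> {set VH}) (k : nat) : Prop :=
  forall v, #|L v| = k.

Definition indep_transversal (T : finType) (VH : finType) (h : rel VH)
    (L : T -> {set VH}) (I : {set VH}) : Prop :=
  (forall x y, x \in I -> y \in I -> ~~ h x y) /\
  (forall v, #|I :&: L v| = 1%N).

Definition has_packing (T : finType) (VH : finType) (h : rel VH)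
    (L : T -> {set VH}) (k : nat) : Prop :=
  exists P : 'I_k -> {set VH},
    (forall i, indep_transversal h L (P i)) /\
    (forall i j, i != j -> [disjoint P i & P j]).

Definition all_corr_covers_pack (T : finType) (e : rel T) (k : nat) : Prop :=
  forall (VH : finType) (h : rel VH) (L : T -> {set VH}),
    corr_cover e h L -> k_fold L k -> has_packing h L k.

(* chi_c^star(G) <= m, where chi_c^star(G) is the least k >= 1 such that every
   k-fold correspondence-cover has a packing: i.e. some such k <= m exists. *)
Definition chi_c_star_le (T : finType) (e : rel T) (m : nat) : Prop :=
  exists k, (1 <= k <= m)%N /\ all_corr_covers_pack e k.

(* Main.v *)
(** The packing problem is recast as a colouring by permutations.  Number
    each list [L v] by [label v : 'I_4 -> L v]; a family of 4 disjoint
    transversals is then a map [col] sending each vertex to a permutation of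
    ['I_4], the [i]-th transversal choosing [label v (col v i)].  The matching
    between [L u] and [L v] extends to a permutation [clash u v], and [col]
    yields independent transversals as soon as [col v] and [col u * clash u v]
    differ everywhere for every edge [uv].

    A discharging argument
    (vertices of degree at least 4 send 1/2 to each neighbour of degree 3)
    shows that [mad < 10/3] forces either a vertex of degree at most 2 or a
    vertex of degree 3 with two neighbours of degree 3.  Both configurations
    are reducible: any two permutations of a 4-set are avoided everywhere by a
    third one, and the three degree-3 vertices (forming a triangle or a path)
    can always be recoloured; these facts about [S_4] are checked by
    computation. *)

Require Import Defs.
From mathcomp Require Import all_boot all_order all_algebra all_fingroup.
From mathcomp Require Import zify lra.
Set Implicit Arguments. Unset Strict Implicit. Unset Printing Implicit Defensive.
Import GRing.Theory Num.Theory.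

Section Avoidance.
Variable X : finType.

Lemma partial_bijection_perm (R : rel X) :
    (forall a b b', R a b -> R a b' -> b = b') ->
    (forall a a' b, R a b -> R a' b -> a = a') ->
  exists p : {perm X}, forall a b, R a b -> p a = b.
Proof.
move=> R_fun R_inj.
suff [p Dp] : exists p : {perm X}, forall a b, a \in [set: X] -> R a b -> p a = b.
  by exists p => a b; apply: Dp; rewrite inE.
have [n] := ubnP #|[set: X]|; elim: n [set: X] => // n IH D.
have [-> _ | [a Da] ltDn] := set_0Vmem D; first by exists 1%g => ? ?; rewrite inE.
have [p Dp] : exists p : {perm X}, forall x y, x \in D :\ a -> R x y -> p x = y.
  by apply: IH; rewrite (cardsD1 a D) Da in ltDn.
have [b Rab | noRa] := pickP (R a); last first.
  exists p => x y Dx Rxy; apply: (Dp x y) => //; rewrite !inE Dx andbT.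
  by apply: (contraTneq _ Rxy) => ->; rewrite noRa.
exists (p * tperm (p a) b)%g => x y Dx Rxy; rewrite permM.
have [xa | xa] := eqVneq x a; first by move: Rxy; rewrite xa tpermL => /(R_fun _ _ _ Rab).
have Dxa : x \in D :\ a by rewrite !inE xa.
rewrite (Dp x y Dxa Rxy) tpermD //.
  by rewrite -(Dp x y Dxa Rxy) (inj_eq perm_inj) eq_sym.
by apply: contra_neq xa => yb; apply: R_inj Rxy _; rewrite -yb.
Qed.

Definition avoid (s t : {perm X}) := [forall i, s i != t i].

Definition avoids (s : {perm X}) (F : {set {perm X}}) := [forall t in F, avoid s t].

Lemma avoidMr s t p : avoid (s * p) (t * p) = avoid s t.
Proof. by apply: eq_forallb => i; rewrite !permM (inj_eq perm_inj). Qed.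

Lemma avoid_mulr s t p : avoid (s * p) t = avoid s (t * p^-1).
Proof. by rewrite -(avoidMr s _ p) mulgKV. Qed.

Lemma avoids_pair s a b (F : {set {perm X}}) :
  F \subset [set a; b] -> avoid s a -> avoid s b -> avoids s F.
Proof.
move=> /subsetP sFab sa sb; apply/forall_inP => t /sFab.
by rewrite !inE => /orP [] /eqP ->.
Qed.

Lemma card_le2_pair (x0 : X) (A : {set X}) :
  #|A| <= 2 -> exists a b, A \subset [set a; b].
Proof.
rewrite cardE => leA2; exists (nth x0 (enum A) 0), (nth x0 (enum A) 1).
apply/subsetP => x; rewrite -mem_enum !inE.
by case: (enum A) leA2 => [|a [|b [|]]] //= _; rewrite !inE ?orbF => // /eqP ->; rewrite eqxx.
Qed.

Lemma card_le1_single (x0 : X) (A : {set X}) :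
  #|A| <= 1 -> exists a, A \subset [set a].
Proof.
move=> /card_le1_eqP A1; have [-> | [a Aa]] := set_0Vmem A.
  by exists x0; apply: sub0set.
by exists a; apply/subsetP => x Ax; rewrite inE (A1 x a).
Qed.

End Avoidance.

(* Written with [if] rather than [&&]/[||], so that [vm_compute], which is
   call-by-value, stops at the first decisive element. *)
Fixpoint allb (A : Type) (p : A -> bool) (s : seq A) : bool :=
  if s is x :: s' then (if p x then allb p s' else false) else true.

Fixpoint hasb (A : Type) (p : A -> bool) (s : seq A) : bool :=
  if s is x :: s' then (if p x then true else hasb p s') else false.

Lemma allbE (A : Type) (p : A -> bool) s : allb p s = all p s.
Proof. by elim: s => //= x s ->; case: (p x). Qed.

Lemma hasbE (A : Type) (p : A -> bool) s : hasb p s = has p s.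
Proof. by elim: s => //= x s ->; case: (p x). Qed.

Lemma has_count_and (A : Type) (p q1 q2 : pred A) s :
    count (fun x => p x && ~~ q1 x) s + count (fun x => p x && ~~ q2 x) s < count p s ->
  has (fun x => [&& p x, q1 x & q2 x]) s.
Proof.
elim: s => //= x s IH.
by case: (p x) (q1 x) (q2 x) => [] [] [] //= lt; apply: IH; lia.
Qed.

(* The finite facts about [S_4] below are checked on value sequences: [code p]
   is the sequence of values of [p], and [perms4] enumerates all of them.  The
   checks take the enumeration as an argument, so that [vm_compute] evaluates
   [perms4] only once. *)
Definition code (p : {perm 'I_4}) : seq nat := [seq val (p i) | i <- enum 'I_4].

Definition perms4 : seq (seq nat) := permutations (iota 0 4).

Lemma code_perms4 p : code p \in perms4.
Proof.
have -> : code p = map val (map p (enum 'I_4)) by rewrite -map_comp.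
rewrite mem_permutations -val_enum_ord; apply/perm_map/uniq_perm.
- by rewrite map_inj_uniq ?enum_uniq //; apply: perm_inj.
- exact: enum_uniq.
by move=> i; rewrite mem_enum; apply/mapP; exists (p^-1 i)%g; rewrite ?mem_enum ?permKV.
Qed.

Lemma perms4_code s : s \in perms4 -> exists p, code p = s.
Proof.
rewrite mem_permutations => s_perm.
have s_size : size s = 4 by rewrite (perm_size s_perm) size_iota.
have s_lt (i : 'I_4) : nth 0 s i < 4.
  have : nth 0 s i \in iota 0 4 by rewrite -(perm_mem s_perm) mem_nth ?s_size.
  by rewrite mem_iota.
pose f (i : 'I_4) : 'I_4 := inord (nth 0 s i).
have f_inj : injective f.
  move=> i j /(congr1 val); rewrite /= !inordK // => /eqP.
  by rewrite nth_uniq ?s_size ?(perm_uniq s_perm) ?iota_uniq // => /eqP /val_inj.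
exists (perm f_inj); rewrite -[RHS](mkseq_nth 0) s_size /mkseq -val_enum_ord -map_comp.
by apply: eq_map => i /=; rewrite permE inordK.
Qed.

Fixpoint avoidc (s t : seq nat) : bool :=
  if s is a :: s' then (if t is b :: t' then (if eqn a b then false else avoidc s' t') else false)
  else if t is [::] then true else false.

Lemma avoidcE s t : avoidc s t = all2 (fun a b => a != b) s t.
Proof.
by elim: s t => [|a s IH] [|b t] //=; rewrite IH -[eqn a b]/(a == b); case: (a == b).
Qed.

Lemma avoid_code s t : avoid s t = avoidc (code s) (code t).
Proof.
have all2_code (l : seq 'I_4) : all2 (fun a b => a != b)
    [seq val (s i) | i <- l] [seq val (t i) | i <- l] = all (fun i => s i != t i) l.
  by elim: l => //= i l ->.
by rewrite avoidcE all2_code; apply/forallP/allP => st i; last apply: st; rewrite ?mem_enum.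
Qed.

Definition code_mul (s k : seq nat) := [seq nth 0 k a | a <- s].

Lemma code_mulE s k : code (s * k) = code_mul (code s) (code k).
Proof.
rewrite /code_mul /code -map_comp; apply: eq_map => i /=.
by rewrite permM (nth_map ord0) ?size_enum_ord // nth_ord_enum.
Qed.

Lemma allb_perms4 f : allb f perms4 -> forall p, f (code p).
Proof. by rewrite allbE => /allP f_all p; apply/f_all/code_perms4. Qed.

Lemma hasb_perms4 f : hasb f perms4 -> exists p, f (code p).
Proof. by rewrite hasbE => /hasP [s /perms4_code [p <-]]; exists p. Qed.

Definition avoid2_check (P : seq (seq nat)) :=
  allb (fun a => allb (fun b => hasb (fun s => avoidc s a && avoidc s b) P) P) P.

Lemma avoid2_perm4 (a b : {perm 'I_4}) : exists s, avoid s a && avoid s b.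
Proof.
have /allb_perms4/(_ a)/allb_perms4/(_ b)/hasb_perms4 [s] : avoid2_check perms4 by vm_compute.
by rewrite -!avoid_code; exists s.
Qed.

Definition triangle_check (P : seq (seq nat)) :=
  allb (fun a => allb (fun b => allb (fun c => allb (fun k =>
  hasb (fun su => if avoidc su a then
  hasb (fun sx => if avoidc sx b && avoidc sx su then
  hasb (fun sy => if avoidc sy c && avoidc sy su then avoidc sy (code_mul sx k) else false) P
  else false) P else false) P) P) P) P) P.

Lemma triangle_perm4 (a b c k : {perm 'I_4}) : exists su sx sy,
  [&& avoid su a, avoid sx b, avoid sx su, avoid sy c, avoid sy su & avoid sy (sx * k)].
Proof.
have : triangle_check perms4 by vm_compute.
move=> /allb_perms4/(_ a)/allb_perms4/(_ b)/allb_perms4/(_ c)/allb_perms4/(_ k).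
move=> /hasb_perms4 [su] /andP [su_a /hasb_perms4 [sx]] /andP [/andP [sx_b sx_su]].
move=> /hasb_perms4 [sy] /andP [/andP [sy_c sy_su]]; rewrite -code_mulE => sy_k.
by exists su, sx, sy; rewrite !avoid_code su_a sx_b sx_su sy_c sy_su sy_k.
Qed.

Definition avoidable3c (P : seq (seq nat)) a b s :=
  hasb (fun t => [&& avoidc t a, avoidc t b & avoidc t s]) P.

Definition derangements_check (P : seq (seq nat)) := allb (fun a => 8 < count (avoidc^~ a) P) P.

Definition path_check (P : seq (seq nat)) :=
  allb (fun a => allb (fun b1 => allb (fun b2 =>
  count (fun su => if avoidc su a then ~~ avoidable3c P b1 b2 su else false) P <= 4)
  P) P) P.

Lemma path_perm4 (a b1 b2 c1 c2 : {perm 'I_4}) : exists su sx sy,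
  [&& avoid su a, avoid sx b1, avoid sx b2, avoid sx su, avoid sy c1, avoid sy c2 & avoid sy su].
Proof.
(* Each [a] is avoided by 9 permutations [su], and each of the two completions
   (to [sx] and to [sy]) fails for at most 4 of them. *)
have few_bad x1 x2 : count (fun su =>
    avoidc su (code a) && ~~ avoidable3c perms4 (code x1) (code x2) su) perms4 <= 4.
  have : path_check perms4 by vm_compute.
  by move=> /allb_perms4/(_ a)/allb_perms4/(_ x1)/allb_perms4/(_ x2).
have many : 8 < count (avoidc^~ (code a)) perms4.
  by have /allb_perms4/(_ a) : derangements_check perms4 by vm_compute.
have := has_count_and (leq_ltn_trans (leq_add (few_bad b1 b2) (few_bad c1 c2)) many).
move=> /hasP [_ /perms4_code [su <-] /and3P [su_a /hasb_perms4 [sx] sx_ok /hasb_perms4 [sy] sy_ok]].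
exists su, sx, sy; move: sx_ok sy_ok; rewrite !avoid_code su_a.
by case/and3P => -> -> -> /and3P [-> -> ->].
Qed.

Lemma avoid_two (F : {set {perm 'I_4}}) : #|F| <= 2 -> exists s, avoids s F.
Proof.
move=> /(card_le2_pair 1%g) [a [b Fab]]; have [s /andP [sa sb]] := avoid2_perm4 a b.
by exists s; apply: avoids_pair Fab sa sb.
Qed.

Lemma avoid_triangle (Fu Fx Fy : {set {perm 'I_4}}) p q r :
    #|Fu| <= 1 -> #|Fx| <= 1 -> #|Fy| <= 1 ->
  exists su sx sy, [&& avoids su Fu, avoids sx Fx, avoids sy Fy,
    avoid sx (su * p), avoid sy (su * q) & avoid sy (sx * r)]%g.
Proof.
move=> /(card_le1_single 1%g) [a]; rewrite -[[set a]]setUid => Fua.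
move=> /(card_le1_single 1%g) [b]; rewrite -[[set b]]setUid => Fxb.
move=> /(card_le1_single 1%g) [c]; rewrite -[[set c]]setUid => Fyc.
have [su [sx [sy]]] := triangle_perm4 a (b * p^-1) (c * q^-1) (p * r * q^-1).
case/and5P => su_a sx_b sx_su sy_c /andP [sy_su]; rewrite !mulgA => sy_sx.
exists su, (sx * p)%g, (sy * q)%g; rewrite !avoidMr avoid_mulr sx_su sy_su sy_sx !andbT.
apply/and3P; split.
- exact: (avoids_pair Fua su_a su_a).
- by apply: avoids_pair Fxb _ _; rewrite avoid_mulr.
- by apply: avoids_pair Fyc _ _; rewrite avoid_mulr.
Qed.

Lemma avoid_path (Fu Fx Fy : {set {perm 'I_4}}) p q :
    #|Fu| <= 1 -> #|Fx| <= 2 -> #|Fy| <= 2 ->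
  exists su sx sy, [&& avoids su Fu, avoids sx Fx, avoids sy Fy,
    avoid sx (su * p) & avoid sy (su * q)]%g.
Proof.
move=> /(card_le1_single 1%g) [a]; rewrite -[[set a]]setUid => Fua.
move=> /(card_le2_pair 1%g) [b1 [b2 Fxb]].
move=> /(card_le2_pair 1%g) [c1 [c2 Fyc]].
have [su [sx [sy]]] := path_perm4 a (b1 * p^-1) (b2 * p^-1) (c1 * q^-1) (c2 * q^-1).
case/and5P => su_a sx_b1 sx_b2 sx_su /and3P [sy_c1 sy_c2 sy_su].
exists su, (sx * p)%g, (sy * q)%g; rewrite !avoidMr sx_su sy_su !andbT.
apply/and3P; split.
- exact: (avoids_pair Fua su_a su_a).
- by apply: avoids_pair Fxb _ _; rewrite avoid_mulr.
- by apply: avoids_pair Fyc _ _; rewrite avoid_mulr.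
Qed.

Section Discharging.
Variables (T : finType) (e : rel T).
Hypothesis e_sym : symmetric e.

Definition nbrs (A : {set T}) v := [set w in A | e v w].

Definition deg (A : {set T}) v := #|nbrs A v|.

Lemma degE S v : deg S v = \sum_(w in S | e v w) 1.
Proof. by rewrite sum1_card; apply: eq_card => w; rewrite !inE. Qed.

Lemma card_nbrs_setD (S R : {set T}) v : R \subset S ->
  #|nbrs (S :\: R) v| + #|nbrs R v| = deg S v.
Proof.
move=> /subsetP RS; rewrite /deg -(cardsID R (nbrs S v)) addnC.
congr (_ + _); apply: eq_card => w; rewrite !inE; last by rewrite andbA.
by case wR: (w \in R); rewrite ?andbF // (RS _ wR) andbT.
Qed.

Lemma sub_nbrs (R : {set T}) r a b :
  a \in R -> b \in R -> e r a -> e r b -> [set a; b] \subset nbrs R r.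
Proof. by move=> aR bR ra rb; apply/subsetP => w; rewrite !inE => /orP [] /eqP ->; apply/andP. Qed.

Lemma sum_deg_lt (S : {set T}) : mad_lt e (10%:R / 3%:R)%R -> S != set0 ->
  3 * \sum_(v in S) deg S v < 10 * #|S|.
Proof.
move=> mad S0; have := mad S e S0 e_sym (fun _ _ => id).
rewrite /avg_deg ltr_pdivrMr ?ltr0n ?card_gt0 // -(ltr_nat rat) !natrM.
by rewrite /deg /nbrs; lra.
Qed.

Lemma sum_edges_swap (S : {set T}) (F : T -> T -> nat) :
  \sum_(v in S) \sum_(w in S | e v w) F v w = \sum_(v in S) \sum_(w in S | e v w) F w v.
Proof.
rewrite (exchange_big_dep (fun w => w \in S)) /=; last by move=> v w _ /andP [].
by apply: eq_bigr => w wS; apply: eq_bigl => v; rewrite wS e_sym.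
Qed.

(* [18] plus six times the charge [v] receives from [w] under the rule "every
   vertex of degree at least 4 sends 1/2 to each neighbour of degree 3".  The
   final charge of [v], starting from [3 * deg v - 10], is then
   [(\sum_w weight v w - 60) / 6]. *)
Definition weight (S : {set T}) v w : nat :=
  if deg S v == 3 then (if deg S w == 3 then 18 else 21)
  else (if deg S w == 3 then 15 else 18).

Lemma sum_weight (S : {set T}) :
  \sum_(v in S) \sum_(w in S | e v w) weight S v w = 18 * \sum_(v in S) deg S v.
Proof.
apply/eqP; rewrite -(eqn_pmul2l (_ : 0 < 2)) // mul2n -addnn {2}sum_edges_swap -big_split.
rewrite mulnA big_distrr; apply/eqP/eq_bigr => v _; rewrite -big_split degE big_distrr.
by apply: eq_bigr => w _; rewrite /weight; case: (deg S v == 3); case: (deg S w == 3).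
Qed.

Lemma sum_nbrs_const (S : {set T}) v c : \sum_(w in S | e v w) c = c * deg S v.
Proof. by rewrite degE big_distrr /= muln1. Qed.

Lemma weight_at_vertex (S : {set T}) v :
    3 <= deg S v -> (deg S v = 3 -> #|[set w in nbrs S v | deg S w == 3]| <= 1) ->
  60 <= \sum_(w in S | e v w) weight S v w.
Proof.
have [d3 _ le1 | dn3 d4] := eqVneq (deg S v) 3.
  have cnt : \sum_(w in S | e v w) (deg S w == 3) = #|[set w in nbrs S v | deg S w == 3]|.
    rewrite -sum1_card big_mkcond [RHS]big_mkcond; apply: eq_bigr => w _; rewrite !inE.
    by case: (w \in S); case: (e v w); case: (deg S w == 3).
  have : \sum_(w in S | e v w) 21 <= \sum_(w in S | e v w) (weight S v w + 3 * (deg S w == 3)).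
    by apply: leq_sum => w _; rewrite /weight d3; case: (deg S w == 3).
  by rewrite big_split /= -big_distrr /= cnt sum_nbrs_const d3; have := le1 d3; lia.
have : \sum_(w in S | e v w) 15 <= \sum_(w in S | e v w) weight S v w.
  by apply: leq_sum => w _; rewrite /weight (negbTE dn3); case: (deg S w == 3).
by rewrite sum_nbrs_const; lia.
Qed.

Lemma discharging (S : {set T}) :
    {in S, forall v, 3 <= deg S v} ->
    {in S, forall v, deg S v = 3 -> #|[set w in nbrs S v | deg S w == 3]| <= 1} ->
  10 * #|S| <= 3 * \sum_(v in S) deg S v.
Proof.
move=> deg3 few3; suff : 60 * #|S| <= 18 * \sum_(v in S) deg S v by lia.
rewrite -sum_weight mulnC -sum_nat_const; apply: leq_sum => v vS.
by apply: weight_at_vertex; [apply: deg3 | apply: few3].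
Qed.

Lemma reducible_config (S : {set T}) :
    mad_lt e (10%:R / 3%:R)%R -> S != set0 ->
  (exists2 v, v \in S & deg S v <= 2) \/
  (exists u x y, [/\ u \in S, x \in S, y \in S, x != y &
     [/\ e u x, e u y, deg S u = 3, deg S x = 3 & deg S y = 3]]).
Proof.
move=> mad S0.
have [/existsP [v /andP [vS dv]] | no_low] := boolP [exists v in S, deg S v <= 2].
  by left; exists v.
right; have deg3 : {in S, forall v, 3 <= deg S v}.
  by move=> v vS; rewrite leqNgt; apply: contra no_low => dv; apply/existsP; exists v; rewrite vS.
pose many3 u := [set w in nbrs S u | deg S w == 3].
have [/existsP [u /and3P [uS /eqP du /card_gt1P [x [y [Nx Ny xy]]]]] | few3] :=
  boolP [exists u in S, (deg S u == 3) && (1 < #|many3 u|)].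
  move: Nx Ny; rewrite !inE => /andP [/andP [xS eux] /eqP dx] /andP [/andP [yS euy] /eqP dy].
  by exists u, x, y.
have := sum_deg_lt mad S0; rewrite ltnNge discharging //.
move=> u uS du; rewrite leqNgt; apply: contra few3 => many; apply/existsP; exists u.
by rewrite uS du eqxx.
Qed.

End Discharging.

Section Colouring.
Variables (T : finType) (e : rel T) (VH : finType) (h : rel VH) (L : T -> {set VH}).
Hypotheses (e_sym : symmetric e) (e_irr : irreflexive e).
Hypothesis cover : corr_cover e h L.

Lemma cover_sym : symmetric h.
Proof. by case: cover => [[]]. Qed.

Lemma cover_irr : irreflexive h.
Proof. by case: cover => [[]]. Qed.

Lemma cover_list_eq u v x : x \in L u -> x \in L v -> u = v.
Proof.
case: cover => _ [_ [disj _]] xu xv; apply/eqP; apply: contraT => /disj /disjointFr.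
by move=> /(_ x xu); rewrite xv.
Qed.

Lemma cover_nonadj u v x y : u != v -> ~~ e u v -> x \in L u -> y \in L v -> ~~ h x y.
Proof. by case: cover => _ [_ [_ [_ [nonadj _]]]]; apply: nonadj. Qed.

Lemma cover_matching u v x y y' :
  e u v -> x \in L u -> y \in L v -> y' \in L v -> h x y -> h x y' -> y = y'.
Proof. by case: cover => _ [_ [_ [_ [_ matching]]]]; apply: matching. Qed.

Section PermColouring.
Variables (k : nat) (fold : k_fold L k).

Definition label v (i : 'I_k) : VH := enum_val (cast_ord (esym (fold v)) i).

Lemma label_in v i : label v i \in L v.
Proof. exact: enum_valP. Qed.

Lemma label_inj v : injective (label v).
Proof. by move=> i j /enum_val_inj /cast_ord_inj. Qed.

Definition conflict u v a b := h (label u a) (label v b).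

Lemma conflictC u v a b : conflict u v a b = conflict v u b a.
Proof. by rewrite /conflict cover_sym. Qed.

Lemma conflict_fun u v : e u v ->
  forall a b b', conflict u v a b -> conflict u v a b' -> b = b'.
Proof.
move=> euv a b b' c c'; apply/label_inj/(cover_matching euv _ _ _ c c').
all: exact: label_in.
Qed.

Lemma conflict_inj u v : e u v ->
  forall a a' b, conflict u v a b -> conflict u v a' b -> a = a'.
Proof. by rewrite e_sym => evu a a' b; rewrite !(conflictC u); apply: conflict_fun. Qed.

Definition clash u v : {perm 'I_k} :=
  odflt 1%g [pick p : {perm 'I_k} | [forall a, forall b, conflict u v a b ==> (p a == b)]].

Lemma clashP u v a b : e u v -> conflict u v a b -> clash u v a = b.
Proof.
move=> euv; rewrite /clash; case: pickP => [p | none].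
  by move=> /forallP /(_ a) /forallP /(_ b) /implyP p_ok /p_ok /eqP.
have [p p_ok] := partial_bijection_perm (conflict_fun euv) (conflict_inj euv).
move/(_ p)/negbT/negP: none => []; apply/forallP => a'; apply/forallP => b'.
by apply/implyP => /p_ok ->.
Qed.

Definition proper (S : {set T}) (col : T -> {perm 'I_k}) :=
  forall u v, u \in S -> v \in S -> e u v -> forall i, ~~ conflict u v (col u i) (col v i).

Lemma avoid_clash u v s t : e u v -> avoid t (s * clash u v) ->
  forall i, ~~ conflict u v (s i) (t i).
Proof.
move=> euv /forallP t_ok i; apply/negP => /(clashP euv) st.
by move: (t_ok i); rewrite permM st eqxx.
Qed.

Definition forbidden (col : T -> {perm 'I_k}) (A : {set T}) v :=
  [set (col w * clash w v)%g | w in nbrs e A v].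

Lemma proper_add (S : {set T}) v col s : proper S col -> avoids s (forbidden col S v) ->
  proper (v |: S) (fun w => if w == v then s else col w).
Proof.
move=> col_ok /forall_inP s_ok.
have s_new w : w \in S -> e w v -> forall i, ~~ conflict w v (col w i) (s i).
  move=> wS ewv; apply: avoid_clash => //; apply/s_ok/imset_f.
  by rewrite inE wS e_sym.
move=> u w; rewrite !inE; have [-> | uv] := eqVneq u v; have [-> | wv] := eqVneq w v => //=.
- by rewrite e_irr.
- by move=> _ wS evw i; rewrite conflictC; apply: s_new; rewrite // e_sym.
- by move=> uS _ euv; apply: s_new.
- by move=> uS wS; apply: col_ok.
Qed.

Lemma avoids_forbidden_add (A : {set T}) v col s t r : v \notin A ->
    avoids t (forbidden col A r) -> (e v r -> avoid t (s * clash v r)) ->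
  avoids t (forbidden (fun w => if w == v then s else col w) (v |: A) r).
Proof.
move=> vA /forall_inP t_old t_new; apply/forall_inP => f /imsetP [w].
rewrite !inE => /andP [/orP [/eqP -> | wA] erw] ->; first by rewrite eqxx t_new // e_sym.
have wv : w != v by apply: contraNneq vA => <-.
by rewrite (negbTE wv); apply/t_old/imset_f; rewrite inE wA.
Qed.

Lemma proper_add_triple (S : {set T}) u x y col su sx sy :
    u \in S -> x \in S -> y \in S -> x != y -> e u x -> e u y ->
    let D := S :\: [set u; x; y] in proper D col ->
    avoids su (forbidden col D u) -> avoids sx (forbidden col D x) ->
    avoids sy (forbidden col D y) -> avoid sx (su * clash u x) ->
    avoid sy (su * clash u y) -> (e x y -> avoid sy (sx * clash x y)) ->
  exists col', proper S col'.
Proof.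
move=> uS xS yS xy eux euy D col_ok su_ok sx_ok sy_ok sx_su sy_su sy_sx.
have [ux uy] : u != x /\ u != y.
  by split; [apply: contraTneq eux | apply: contraTneq euy] => ->; rewrite e_irr.
have uD : u \notin D by rewrite !inE eqxx.
have xD : x \notin u |: D by rewrite !inE eqxx !orbT /= orbF eq_sym.
have yD : y \notin x |: (u |: D) by rewrite !inE eqxx !orbT /= orbF !(eq_sym y) negb_or xy uy.
set col1 := fun w => if w == u then su else col w.
set col2 := fun w => if w == x then sx else col1 w.
have ok2 : proper (x |: (u |: D)) col2.
  apply: proper_add (proper_add col_ok su_ok) _.
  exact: avoids_forbidden_add uD sx_ok (fun _ => sx_su).
have /proper_add ok3 : avoids sy (forbidden col2 (x |: (u |: D)) y).
  apply: avoids_forbidden_add xD (avoids_forbidden_add uD sy_ok (fun _ => sy_su)) _.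
  exact: sy_sx.
exists (fun w => if w == y then sy else col2 w).
suff -> : S = y |: (x |: (u |: D)) by apply: ok3 ok2.
apply/setP => w; rewrite !inE; case: (w =P y) => [-> | _]; first by rewrite yS.
by case: (w =P x) => [-> | _]; [rewrite xS | case: (w =P u) => [-> | _]; rewrite ?uS ?andbT ?orbF].
Qed.

Lemma packing_of_proper col : proper [set: T] col -> has_packing h L k.
Proof.
move=> col_ok; exists (fun i => [set label v (col v i) | v : T]); split.
  move=> i; split.
    move=> _ _ /imsetP [v _ ->] /imsetP [w _ ->].
    have [<- | vw] := eqVneq v w; first by rewrite cover_irr.
    have [evw | nevw] := boolP (e v w); first exact: col_ok.
    exact: cover_nonadj vw nevw (label_in _ _) (label_in _ _).
  move=> v; have -> : [set label w (col w i) | w : T] :&: L v = [set label v (col v i)].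
    apply/setP => z; rewrite !inE.
    apply/andP/eqP => [[/imsetP [w _ ->] zv] | ->].
      by rewrite (cover_list_eq (label_in _ _) zv).
    by split; [apply: imset_f | apply: label_in].
  by rewrite cards1.
move=> i j ij; rewrite disjoint_subset; apply/subsetP => _ /imsetP [v _ ->].
rewrite inE; apply/negP => /imsetP [w _ vw].
have := label_in v (col v i); rewrite vw => /(cover_list_eq (label_in _ _)) wv.
by rewrite wv in vw; move/label_inj/perm_inj: vw => ij'; rewrite ij' eqxx in ij.
Qed.

End PermColouring.

Variable fold4 : k_fold L 4.

Lemma extend_low_degree (S : {set T}) v col :
  v \in S -> deg e S v <= 2 -> proper fold4 (S :\ v) col -> exists col', proper fold4 S col'.
Proof.
move=> vS dv col_ok.
have [s s_ok] : exists s, avoids s (forbidden fold4 col (S :\ v) v).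
  apply/avoid_two/(leq_trans (leq_imset_card _ _))/(leq_trans _ dv)/subset_leq_card.
  by apply/subsetP => w; rewrite !inE => /andP [/andP [_ ->] ->].
by exists (fun w => if w == v then s else col w); rewrite -(setD1K vS); apply: proper_add.
Qed.

Lemma extend_triple (S : {set T}) u x y col :
    u \in S -> x \in S -> y \in S -> x != y -> e u x -> e u y ->
    deg e S u = 3 -> deg e S x = 3 -> deg e S y = 3 ->
    proper fold4 (S :\: [set u; x; y]) col -> exists col', proper fold4 S col'.
Proof.
move=> uS xS yS xy eux euy du dx dy col_ok; set R := [set u; x; y].
have RS : R \subset S by apply/subsetP => w; rewrite !inE -orbA => /or3P [] /eqP ->.
have [uR xR yR] : [/\ u \in R, x \in R & y \in R] by rewrite !inE !eqxx !orbT.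
have [exu eyu] : e x u /\ e y u by rewrite !(e_sym _ u).
have [ux uy] : u != x /\ u != y.
  by split; [apply: contraTneq eux | apply: contraTneq euy] => ->; rewrite e_irr.
have outer r a b : a \in R -> b \in R -> e r a -> e r b -> deg e S r = 3 ->
    #|forbidden fold4 col (S :\: R) r| <= 3 - #|[set a; b]|.
  move=> aR bR ra rb dr; apply: leq_trans (leq_imset_card _ _) _.
  apply: leq_trans _ (leq_sub2l 3 (subset_leq_card (sub_nbrs aR bR ra rb))).
  by rewrite -dr -(card_nbrs_setD e r RS) addnK.
have := outer u x y xR yR eux euy du; rewrite cards2 xy => fu.
have [exy | nexy] := boolP (e x y).
  have := outer x u y uR yR exu exy dx; rewrite cards2 uy => fx.
  have := outer y u x uR xR eyu (etrans (e_sym y x) exy) dy; rewrite cards2 ux => fy.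
  have := avoid_triangle (clash fold4 u x) (clash fold4 u y) (clash fold4 x y) fu fx fy.
  case=> [su [sx [sy /and5P [su_ok sx_ok sy_ok sx_su /andP [sy_su sy_sx]]]]].
  apply: proper_add_triple uS xS yS xy eux euy col_ok su_ok sx_ok sy_ok sx_su sy_su _.
  by move=> _.
have := outer x u u uR uR exu exu dx; rewrite setUid cards1 => fx.
have := outer y u u uR uR eyu eyu dy; rewrite setUid cards1 => fy.
have [su [sx [sy]]] := avoid_path (clash fold4 u x) (clash fold4 u y) fu fx fy.
case/and5P => su_ok sx_ok sy_ok sx_su sy_su.
apply: proper_add_triple uS xS yS xy eux euy col_ok su_ok sx_ok sy_ok sx_su sy_su _.
by rewrite (negbTE nexy).
Qed.

Lemma proper_colouring (S : {set T}) :
  mad_lt e (10%:R / 3%:R)%R -> exists col, proper fold4 S col.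
Proof.
move=> mad; have [n] := ubnP #|S|; elim: n S => // n IH S ltSn.
have [-> | S0] := eqVneq S set0; first by exists (fun=> 1%g) => u v; rewrite inE.
have [[v vS dv] | [u [x [y [uS xS yS xy [eux euy du dx dy]]]]]] := reducible_config e_sym mad S0.
  have [col col_ok] : exists col, proper fold4 (S :\ v) col.
    by apply: IH; rewrite (cardsD1 v S) vS in ltSn.
  exact: extend_low_degree vS dv col_ok.
have [col col_ok] : exists col, proper fold4 (S :\: [set u; x; y]) col.
  apply: IH; have : 0 < #|S :&: [set u; x; y]| by apply/card_gt0P; exists u; rewrite !inE uS eqxx.
  by rewrite -(cardsID [set u; x; y] S) in ltSn; lia.
exact: extend_triple uS xS yS xy eux euy du dx dy col_ok.
Qed.

End Colouring.

Theorem mainTheorem2 (T : finType) (e : rel T) :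
  simple_graph e -> mad_lt e (10%:R / 3%:R)%R -> chi_c_star_le e 4.
Proof.
move=> [e_sym e_irr] mad; exists 4; split => // VH h L cover fold4.
have [col col_ok] := proper_colouring e_sym e_irr cover fold4 [set: T] mad.
exact: packing_of_proper col_ok.
Qed.
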